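(* Let $P_1,\dots,P_m$ be the list of equivalence classes of the relation $\sim$ on $\mathcal{IS}_n$. Then $$\operatorname{Aut}(\mathcal{IS}_n,* )=\Bigl(\bigoplus_{i=1}^{m}\mathcal{S}(P_i)\Bigr)\rtimes\Bigl(\mathcal{S}(A)\times\mathcal{S}(\overline{A})\times\mathcal{S}(\overline{A})\Bigr),$$ where both factors are regarded as subgroups of $\operatorname{Aut}(\mathcal{IS}_n,* )$ as described in the context, and $\bigoplus_{i=1}^{m}\mathcal{S}(P_i)$ is the normal factor of the (internal) semidirect product.
   Context: $N=\{1,\dots,n\}$, and $\mathcal{IS}_n$ is the set (finite inverse symmetric semigroup) of all partial injective transformations of $N$; $\operatorname{dom}(a)$ and $\operatorname{im}(a)$ are the domain and image of $a$, and $\operatorname{rank}(a)=|\operatorname{im}(a)|$. Composition of maps is from left to right, so $(ab)(x)=b(a(x))$; automorphisms are also composed from left to right. Let $1\le k\le n$, $A=\{1,2,\dots,k\}\subseteq N$, $\overline{A}=N\setminus A$, and let $e\in\mathcal{IS}_n$ be the idempotent with $\operatorname{dom}(e)=A$ acting identically on $A$. $(\mathcal{IS}_n,* )$ denotes the sandwich semigroup on the set $\mathcal{IS}_n$ with multiplication $a*b=aeb$. For a set $K$, $\mathcal{S}(K)$ is the full symmetric group on $K$. An element $a$ is decomposable in $(\mathcal{IS}_n,* )$ if $a=b*c$ for some $b,c\in\mathcal{IS}_n$, and indecomposable otherwise. Let $\mathrm{Q}$ be the set of all indecomposable elements of $(\mathcal{IS}_n,* )$. For $a\in\mathrm{Q}$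 put $M_1(a)=\{x\in\operatorname{dom}(a): x\in A,\ a(x)\in A\}$, $M_2(a)=\{x\in\operatorname{dom}(a): x\in A,\ a(x)\in\overline{A}\}$, $M_3(a)=\{x\in\operatorname{dom}(a): x\in\overline{A},\ a(x)\in A\}$. The relation $\sim$ on $\mathcal{IS}_n$ is defined as follows: for $a,b\in\mathrm{Q}$, $a\sim b$ iff $M_i(a)=M_i(b)$ for $1\le i\le 3$ and $a(x)=b(x)$ for all $x\in M_1(a)\cup M_2(a)\cup M_3(a)$; if at least one of $a,b$ is not in $\mathrm{Q}$, then $a\sim b$ iff $a=b$. Identifications: $\bigoplus_{i=1}^m\mathcal{S}(P_i)$ is identified with the group of all permutations $\pi$ of the set $\mathcal{IS}_n$ with $\pi(P_i)=P_i$ for every $i$. A triple $(g,h_1,h_2)\in\mathcal{S}(A)\times\mathcal{S}(\overline{A})\times\mathcal{S}(\overline{A})$ is identified with the map $\tau_{(g,h_1,h_2)}:a\mapsto({}_gh_1)^{-1}\,a\,({}_gh_2)$ on $\mathcal{IS}_n$, where for $g\in\mathcal{S}(A)$, $h\in\mathcal{S}(\overline{A})$, ${}_gh\in\mathcal{IS}_n$ is the permutation of $N$ acting as $g$ on $A$ and as $h$ on $\overline{A}$, and the products are ordinary (left-to-right) composition in $\mathcal{IS}_n$. *)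

(* Defs.v *)
From HB Require Import structures.
From mathcomp Require Import all_boot all_fingroup.

Set Implicit Arguments.
Unset Strict Implicit.
Unset Printing Implicit Defensive.

Local Open Scope group_scope.

Section SymmetricInverseMonoid.

Variable n : nat.

(* A partial injective transformation is an option-valued function, undefined
   at x when its value is None, that is injective where it is defined. The
   underlying set {1, ..., n} is represented by 'I_n, i.e. {0, ..., n - 1}. *)
Record IS := PInj {
  pfun :> {ffun 'I_n -> option 'I_n};
  _ : dinjectiveb pfun [pred x | isSome (pfun x)]
}.

HB.instance Definition _ := [isSub for pfun].
HB.instance Definition _ := [Finite of IS by <:].

Implicit Types a b c : IS.

Lemma IS_ext a b : (forall x, a x = b x) -> a = b.
Proof. by move=> eq_ab; apply/val_inj/ffunP. Qed.

Lemma pinj a x y z : a x = Some z -> a y = Some z -> x = y.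
Proof.
case: a => f /= /dinjectiveP f_inj fx fy.
by apply: f_inj; rewrite ?inE ?fx ?fy.
Qed.

Lemma pinj_subproof (f : {ffun 'I_n -> option 'I_n}) :
  (forall x y z, f x = Some z -> f y = Some z -> x = y) ->
  dinjectiveb f [pred x | isSome (f x)].
Proof.
move=> f_inj; apply/dinjectiveP => x y; rewrite !inE.
case fx: (f x) => [z|] // _ _ fy.
exact: f_inj fx (esym fy).
Qed.

Definition pdom a : {set 'I_n} := [set x | isSome (a x)].

Fact pid_subproof :
  let f := [ffun x : 'I_n => Some x] in dinjectiveb f [pred x | isSome (f x)].
Proof. by apply: pinj_subproof => x y z; rewrite !ffunE => -[->] [->]. Qed.

Definition pid : IS := PInj pid_subproof.

(* Left-to-right composition: x is sent to b (a x). *)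
Fact pcomp_subproof a b :
  let f := [ffun x => obind b (a x)] in dinjectiveb f [pred x | isSome (f x)].
Proof.
apply: pinj_subproof => x y z; rewrite !ffunE.
case ax: (a x) => [x'|] //=; case ay: (a y) => [y'|] //= bx by_.
by rewrite (pinj bx by_) in ax; apply: pinj ax ay.
Qed.

Definition pcomp a b : IS := PInj (pcomp_subproof a b).

Fact pcompA : associative pcomp.
Proof.
by move=> a b c; apply: IS_ext => x; rewrite !ffunE; case: (a x) => //= y; rewrite !ffunE.
Qed.

Fact pcomp1l : left_id pid pcomp.
Proof. by move=> a; apply: IS_ext => x; rewrite !ffunE. Qed.

Fact pcomp1r : right_id pid pcomp.
Proof.
by move=> a; apply: IS_ext => x; rewrite !ffunE; case: (a x) => //= y; rewrite !ffunE.
Qed.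

HB.instance Definition _ := isMonoid.Build IS pcompA pcomp1l pcomp1r.

Lemma mulISE a b x : (a * b) x = obind b (a x).
Proof. by rewrite ffunE. Qed.

Fact of_perm_subproof (s : {perm 'I_n}) :
  let f := [ffun x => Some (s x)] in dinjectiveb f [pred x | isSome (f x)].
Proof.
by apply: pinj_subproof => x y z; rewrite !ffunE => -[<-] [/perm_inj].
Qed.

Definition of_perm (s : {perm 'I_n}) : IS := PInj (of_perm_subproof s).

Lemma of_perm1 : of_perm 1 = 1.
Proof. by apply: IS_ext => x; rewrite !ffunE perm1. Qed.

Lemma of_permM s t : of_perm (s * t) = of_perm s * of_perm t.
Proof. by apply: IS_ext => x; rewrite mulISE !ffunE /= ffunE permM. Qed.

Definition translate (s t : {perm 'I_n}) a : IS :=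
  of_perm s^-1 * a * of_perm t.

Lemma translateM s s' t t' a :
  translate (s * s') (t * t') a = translate s' t' (translate s t a).
Proof. by rewrite /translate invMg !of_permM !mulgA. Qed.

Lemma translate1 a : translate 1 1 a = a.
Proof. by rewrite /translate invg1 of_perm1 mul1g mulg1. Qed.

Lemma translate_inj s t : injective (translate s t).
Proof.
by apply: (can_inj (g := translate s^-1 t^-1)) => a; rewrite -translateM !mulgV translate1.
Qed.

End SymmetricInverseMonoid.

Section SandwichSemigroup.

Variables n k : nat.

Implicit Types (a b c : IS n) (s : {perm IS n}) (g h : {perm 'I_n}).

(* With indices starting at 0, {1, ..., k} becomes {x | x < k}. *)
Definition setA : {set 'I_n} := [set x : 'I_n | x < k].

Fact idemA_subproof :
  let f := [ffun x => if x \in setA then Some x else None] in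
  dinjectiveb f [pred x | isSome (f x)].
Proof.
by apply: pinj_subproof => x y z; rewrite !ffunE; do 2![case: ifP => // _] => -[->] [->].
Qed.

Definition idemA : IS n := PInj idemA_subproof.

Definition sandwich a b : IS n := a * idemA * b.

Lemma sandwichA : associative sandwich.
Proof. by move=> a b c; rewrite /sandwich !mulgA. Qed.

Definition AutIS : {set {perm IS n}} :=
  [set s : {perm IS n} | [forall a, forall b, s (sandwich a b) == sandwich (s a) (s b)]].

Lemma AutISP s :
  reflect (forall a b, s (sandwich a b) = sandwich (s a) (s b)) (s \in AutIS).
Proof.
rewrite inE; apply: (iffP forallP) => [H a b | H a].
  by have /forallP/(_ b)/eqP := H a.
by apply/forallP => b; apply/eqP.
Qed.

Fact AutIS_group_set : group_set AutIS.
Proof.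
apply/group_setP; split=> [|s t /AutISP sP /AutISP tP]; apply/AutISP => a b.
  by rewrite !perm1.
by rewrite !permM sP tP.
Qed.

Canonical AutIS_group := Group AutIS_group_set.

Definition decomposable a : bool := [exists b, exists c, a == sandwich b c].

Definition Q : {set IS n} := [set a | ~~ decomposable a].

Definition sends a (x : 'I_n) (B : {set 'I_n}) : bool :=
  [exists y in B, a x == Some y].

Definition M1 a : {set 'I_n} := [set x in pdom a | (x \in setA) && sends a x setA].
Definition M2 a : {set 'I_n} := [set x in pdom a | (x \in setA) && sends a x (~: setA)].
Definition M3 a : {set 'I_n} := [set x in pdom a | (x \in ~: setA) && sends a x setA].

Definition sim : rel (IS n) := fun a b =>
  if (a \in Q) && (b \in Q) then
    [&& M1 a == M1 b, M2 a == M2 b, M3 a == M3 b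
      & [forall x in M1 a :|: M2 a :|: M3 a, a x == b x]]
  else a == b.

Lemma sim_equiv : equivalence_rel sim.
Proof.
apply/equivalence_relP; split=> [a | a b].
  by rewrite /sim !eqxx /=; case: ifP => // _; apply/forall_inP => x _.
rewrite /sim => ab c; move: ab; case: ifP => [/andP[aQ bQ] | _ /eqP-> //].
case/and4P=> /eqP E1 /eqP E2 /eqP E3 /forall_inP ab; rewrite aQ bQ /=.
case: ifPn => cQ.
  rewrite -E1 -E2 -E3; congr [&& _, _, _ & _].
  by apply: eq_forallb_in => x /ab/eqP ->.
by rewrite !(negbTE (memPn cQ _ _)).
Qed.

Definition sim_classes : {set {set IS n}} := equivalence_partition sim setT.

Definition class_perms : {set {perm IS n}} :=
  [set s : {perm IS n} | [forall P in sim_classes, [set s a | a in P] == P]].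

Fact class_perms_group_set : group_set class_perms.
Proof.
apply/group_setP; split=> [|s t]; rewrite !inE.
  apply/forall_inP => P _; apply/eqP; rewrite -[RHS]imset_id.
  by apply: eq_imset => a; rewrite perm1.
move=> /forall_inP sP /forall_inP tP; apply/forall_inP => P PP.
rewrite -{2}(eqP (tP P PP)) -{2}(eqP (sP P PP)) -imset_comp.
by apply/eqP/eq_imset => a; rewrite permM.
Qed.

Canonical class_perms_group := Group class_perms_group_set.

(* S(A) x S(N \ A) x S(N \ A), where the permutations of a subset of 'I_n are
   the permutations of 'I_n that fix every point outside this subset. *)
Definition sym3 := setX (setX (Sym setA) (Sym (~: setA))) (Sym (~: setA)).
Canonical sym3_group := [group of sym3].

(* The permutation of 'I_n acting as g on A and as h on its complement, provided
   that g \in Sym setA and h \in Sym (~: setA) (see glueE below). *)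
Definition glue g h : {perm 'I_n} := g * h.

Lemma glueE g h x : g \in Sym setA -> h \in Sym (~: setA) ->
  glue g h x = if x \in setA then g x else h x.
Proof.
rewrite ![_ \in Sym _]inE => gA hA; rewrite permM; case: ifPn => xA; last by rewrite (out_perm gA xA).
by rewrite (out_perm hA) // in_setC negbK (perm_closed x gA).
Qed.

Lemma glueM g g' h h' : g' \in Sym setA -> h \in Sym (~: setA) ->
  glue (g * g') (h * h') = glue g h * glue g' h'.
Proof.
rewrite ![_ \in Sym _]inE => gA hA; rewrite /glue !mulgA; congr (_ * _); rewrite -!mulgA.
by congr (_ * _); apply: (perm_onC gA hA); rewrite -setI_eq0 setICr.
Qed.

Definition tau_fun (t : {perm 'I_n} * {perm 'I_n} * {perm 'I_n}) : {perm IS n} :=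
  let: (g, h1, h2) := t in perm (@translate_inj n (glue g h1) (glue g h2)).

Lemma tau_funE g h1 h2 a :
  tau_fun (g, h1, h2) a = of_perm (glue g h1)^-1 * a * of_perm (glue g h2).
Proof. by rewrite permE. Qed.

Fact tau_morphic : {in sym3 &, {morph tau_fun : t u / t * u}}.
Proof.
move=> [[g h1] h2] [[g' h1'] h2'] /setXP[/setXP[/= _ h1A] h2A].
move=> /setXP[/setXP[/= gA _] _]; apply/permP => a.
by rewrite permM !permE -translateM /= !glueM.
Qed.

Canonical tau := Morphism tau_morphic.

End SandwichSemigroup.

Arguments setA : clear implicits.
Arguments sim_classes : clear implicits.
Arguments AutIS : clear implicits.
Arguments class_perms : clear implicits.
Arguments sym3 : clear implicits.
Arguments tau : clear implicits.

(* Main.v *)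
(** An automorphism phi permutes the rank-one maps [x -> y].  The nonzero
    idempotents of the sandwich semigroup are the partial identities on
    nonempty subsets of A; since the rank-one ones are minimal, phi sends
    [o -> o] with o in A to some [p -> p] with p in A.  Factoring
    [x -> y] = [x -> o] * [o -> y] then yields permutations alpha, beta with
    phi [x -> y] = [alpha x -> beta y], and idempotency of [x -> x] for x in A
    makes alpha and beta agree on A and stabilize it.  Hence phi coincides on
    rank-one maps with a translation tau, and psi = phi tau^-1 fixes all of
    them.  Multiplying by [x -> x] for x in A shows that psi preserves e a and
    a e, so it fixes every product b e c, and moves an indecomposable a only
    inside its class, because on indecomposables ~ is equality of both e a
    and a e. *)

Require Import Defs.
From mathcomp Require Import all_boot all_fingroup.

Local Open Scope group_scope.

(** * The zero map and the rank-one maps *)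

Section RankOne.

Context {n : nat}.
Implicit Types (a b : IS n) (x y z : 'I_n) (s t : {perm 'I_n}).

Fact pzero_subproof :
  let f := [ffun _ : 'I_n => None : option 'I_n] in
  dinjectiveb f [pred x | isSome (f x)].
Proof. by apply: pinj_subproof => x y z; rewrite ffunE. Qed.

Definition pzero : IS n := PInj pzero_subproof.

Lemma pzeroE x : pzero x = None.
Proof. by rewrite ffunE. Qed.

Lemma pzero_neqP a : reflect (exists x y, a x = Some y) (a != pzero).
Proof.
apply: (iffP idP) => [a_neq0 | [x [y axy]]]; last first.
  by apply: contra_eq_neq axy => ->; rewrite pzeroE.
have [/existsP[x ax] | /existsPn a0] := boolP [exists x, isSome (a x)].
  by case axy: (a x) ax => [y|] // _; exists x, y.
case/eqP: a_neq0; apply: IS_ext => x; rewrite pzeroE.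
by case: (a x) (a0 x).
Qed.

Fact unit_map_subproof x y :
  let f := [ffun z => if z == x then Some y else None] in
  dinjectiveb f [pred z | isSome (f z)].
Proof.
by apply: pinj_subproof => u v w; rewrite !ffunE; do 2![case: eqP => // ->].
Qed.

Definition unit_map x y : IS n := PInj (unit_map_subproof x y).

Lemma unit_mapE x y z : unit_map x y z = if z == x then Some y else None.
Proof. by rewrite ffunE. Qed.

Lemma unit_map_inj x y x' y' :
  unit_map x y = unit_map x' y' -> x = x' /\ y = y'.
Proof.
move/(congr1 (fun a : IS n => a x)); rewrite !unit_mapE eqxx.
by case: eqP => // -> [->].
Qed.

Lemma unit_map_neq0 x y : unit_map x y != pzero.
Proof. by apply/pzero_neqP; exists x, y; rewrite unit_mapE eqxx. Qed.

Lemma of_permE s x : of_perm s x = Some (s x).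
Proof. by rewrite ffunE. Qed.

Lemma translate_unit_map s t x y :
  of_perm s^-1 * unit_map x y * of_perm t = unit_map (s x) (t y).
Proof.
apply: IS_ext => z; rewrite !mulISE of_permE /= !unit_mapE.
by rewrite (canF_eq (permKV s)); case: eqP => //= _; rewrite of_permE.
Qed.

End RankOne.

Section SandwichAutomorphisms.

Context {n k : nat}.
Local Notation A := (setA n k).
Local Notation e := (idemA n k).
Local Notation sw := (@sandwich n k).

Implicit Types (a b c : IS n) (phi : {perm IS n}) (x y z : 'I_n).

(** * The idempotent [e] and sandwich products with rank-one maps *)

Lemma idemAE x : e x = if x \in A then Some x else None.
Proof. by rewrite ffunE. Qed.

Lemma idemA_mulE a x : (e * a) x = if x \in A then a x else None.
Proof. by rewrite mulISE idemAE; case: ifP. Qed.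

Lemma mul_idemAE a x : (a * e) x = obind e (a x).
Proof. exact: mulISE. Qed.

Lemma idemA_idem : e * e = e.
Proof. by apply: IS_ext => x; rewrite idemA_mulE idemAE; case: (x \in A). Qed.

Lemma sandwich0l a : sw pzero a = pzero.
Proof. by apply: IS_ext => x; rewrite !mulISE pzeroE. Qed.

Lemma sandwich0r a : sw a pzero = pzero.
Proof.
by apply: IS_ext => x; rewrite mulISE; case: (_ x) => /= [y|]; rewrite !pzeroE.
Qed.

Lemma sandwich_unit_mapl x z a : z \in A ->
  sw (unit_map x z) a = if a z is Some y then unit_map x y else pzero.
Proof.
move=> zA; apply: IS_ext => w; rewrite !mulISE unit_mapE.
case: (eqVneq w x) => [-> | wx] /=; last first.
  by case: (a z) => [y|]; rewrite ?unit_mapE ?(negbTE wx) ?pzeroE.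
by rewrite idemAE zA /=; case: (a z) => [y|]; rewrite ?unit_mapE ?eqxx ?pzeroE.
Qed.

(** Any point of [A] can serve as the intermediate point, so rank-one maps are decomposable as soon
    as [A] is nonempty. *)
Lemma sandwich_unit_map x y z : z \in A ->
  sw (unit_map x z) (unit_map z y) = unit_map x y.
Proof. by move=> zA; rewrite sandwich_unit_mapl // unit_mapE eqxx. Qed.

Lemma sandwich_unit_mapr a y z x : y \in A ->
  sw a (unit_map y z) x = if a x == Some y then Some z else None.
Proof.
move=> yA; rewrite !mulISE; case: (a x) => //= w; rewrite idemAE.
case: ifP => [_ | wA] /=; first by rewrite unit_mapE (inj_eq Some_inj).
by case: eqP => // -[wy]; rewrite wy yA in wA.
Qed.

(** By injectivity [a] sends at most one point to [y], so at most one arrow survives the product. *)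
Lemma sandwich_unit_mapr_cases a y z : y \in A ->
  sw a (unit_map y z) = pzero \/ exists x, sw a (unit_map y z) = unit_map x z.
Proof.
move=> yA; have [/existsP[x /eqP ax] | /existsPn ay] := boolP [exists x, a x == Some y].
  right; exists x; apply: IS_ext => w; rewrite sandwich_unit_mapr // unit_mapE.
  case: (eqVneq w x) => [-> | wx]; first by rewrite ax eqxx.
  by case: eqP => // aw; case/eqP: wx; apply: pinj aw ax.
left; apply: IS_ext => w; rewrite sandwich_unit_mapr // pzeroE.
by rewrite (negbTE (ay w)).
Qed.

(** Evaluating [sw a a = a] at [x] gives [y \in A] and [a y = Some y]; injectivity then identifies
    [x] with [y]. *)
Lemma sandwich_idem a x y : sw a a = a -> a x = Some y -> x = y /\ y \in A.
Proof.
move=> aa axy; have: sw a a x = Some y by rewrite aa.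
rewrite !mulISE axy /= idemAE; case: ifP => //= yA ay.
by split=> //; apply: pinj axy ay.
Qed.

(** Puts equality of the restrictions to [A] in terms of the sandwich operation alone, so that
    automorphisms transport it; for the converse, [c] is the identity map. *)
Lemma idemA_mul_sandwich a b : e * a = e * b <-> forall c, sw c a = sw c b.
Proof.
split=> [ab c | /(_ 1)]; last by rewrite /sandwich !mul1g.
by rewrite /sandwich -!mulgA ab.
Qed.

Lemma mul_idemA_sandwich a b : a * e = b * e <-> forall c, sw a c = sw b c.
Proof.
split=> [ab c | /(_ 1)]; last by rewrite /sandwich !mulg1.
by rewrite /sandwich ab.
Qed.

(** * The relation ~ in terms of [e * a] and [a * e] *)

Lemma sendsE a x (B : {set 'I_n}) :
  sends a x B = if a x is Some y then y \in B else false.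
Proof.
apply/exists_inP/idP => [[y yB /eqP->] // |].
by case: (a x) => // y yB; exists y.
Qed.

Lemma in_M1 a x : (x \in M1 k a) = (x \in A) && sends a x A.
Proof. by rewrite !in_set sendsE; case: (a x) => //=; rewrite andbF. Qed.

Lemma in_M2 a x : (x \in M2 k a) = (x \in A) && sends a x (~: A).
Proof. by rewrite !in_set sendsE; case: (a x) => //=; rewrite andbF. Qed.

Lemma in_M3 a x : (x \in M3 k a) = (x \in ~: A) && sends a x A.
Proof. by rewrite !in_set sendsE; case: (a x) => //=; rewrite andbF. Qed.

Lemma in_M123 a x :
  (x \in M1 k a :|: M2 k a :|: M3 k a) =
  if x \in A then isSome (a x) else sends a x A.
Proof.
rewrite !in_setU in_M1 in_M2 in_M3 !sendsE in_setC.
case: ifP => //= _; rewrite orbF.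
by case: (a x) => //= y; rewrite in_setC orbN.
Qed.

Lemma mul_idemA_sends a x : (a * e) x = if sends a x A then a x else None.
Proof.
by rewrite mul_idemAE sendsE; case: (a x) => //= y; rewrite idemAE.
Qed.

Lemma sends_mul_idemA a x : sends a x A = isSome ((a * e) x).
Proof.
by rewrite mul_idemAE sendsE; case: (a x) => //= y; rewrite idemAE; case: ifP.
Qed.

(** [e * a] is [a] restricted to [A], recorded by the values on [M1] and [M2]; [a * e] is [a]
    restricted to the points sent into [A], recorded by the values on [M1] and [M3]. *)
Lemma simP a b :
  reflect (a = b \/ [/\ a \in Q n k, b \in Q n k, e * a = e * b & a * e = b * e])
          (sim k a b).
Proof.
rewrite /sim; case: ifPn => [/andP[aQ bQ] | nQ]; last first.
  apply: (iffP eqP) => [-> | [] // [aQ bQ]]; first by left.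
  by rewrite aQ bQ in nQ.
apply: (iffP and4P) => [[/eqP E1 /eqP E2 /eqP E3 /forall_inP ab] | ].
  have eqab x : (x \in M1 k a :|: M2 k a :|: M3 k a) ||
                (x \in M1 k b :|: M2 k b :|: M3 k b) -> a x = b x.
    by rewrite -E1 -E2 -E3 orbb => /ab/eqP.
  have sends_in c x : sends c x A -> x \in M1 k c :|: M2 k c :|: M3 k c.
    by rewrite in_M123; case: ifP => // _; rewrite sendsE; case: (c x).
  right; split=> //; apply: IS_ext => x.
    have := eqab x; rewrite !idemA_mulE !in_M123; case: ifP => // _.
    by case: (a x) => [y|]; case: (b x) => [y'|] //; apply.
  rewrite !mul_idemA_sends.
  have [s_ab | /norP[/negbTE-> /negbTE-> //]] := boolP (sends a x A || sends b x A).
  by rewrite !sendsE eqab //; case/orP: s_ab => /sends_in->; rewrite ?orbT.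
case=> [-> | [_ _ eab aeb]].
  by rewrite !eqxx; split=> //; apply/forall_inP.
have ab x : x \in A -> a x = b x.
  by move=> xA; have := congr1 (fun c : IS n => c x) eab; rewrite /= !idemA_mulE xA.
have sab x : sends a x A = sends b x A by rewrite !sends_mul_idemA aeb.
split; try by apply/eqP/setP => x;
  rewrite ?in_M1 ?in_M2 ?in_M3 ?sab // !sendsE; case: (boolP (x \in A)) => // /ab->.
apply/forall_inP => x; rewrite in_M123; case: ifP => [/ab-> // | _ ax].
have := congr1 (fun c : IS n => c x) aeb.
by rewrite /= !mul_idemA_sends -sab ax => ->.
Qed.

(** * Permutations preserving the classes *)

Lemma class_permsP (s : {perm IS n}) :
  reflect (forall a, sim k a (s a)) (s \in class_perms n k).
Proof.
have simR := @sim_equiv n k.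
rewrite inE; apply: (iffP forall_inP) => [sP a | sP P].
  have Pa: [set b in setT | sim k a b] \in sim_classes n k.
    by apply: imset_f; rewrite inE.
  have: s a \in [set b in setT | sim k a b].
    by rewrite -(eqP (sP _ Pa)) imset_f // !inE (simR a a a).1.
  by rewrite !inE.
(* The image of a finite class has the cardinality of the class, so inclusion is enough. *)
case/imsetP=> a _ ->; rewrite eqEcard card_imset ?leqnn ?andbT; last exact: perm_inj.
apply/subsetP => _ /imsetP[b + ->]; rewrite !inE /= => ab.
by rewrite (simR a b (s b)).2.
Qed.

Lemma sim_l a b : sim k a b -> e * a = e * b.
Proof. by case/simP=> [-> | []]. Qed.

Lemma sim_r a b : sim k a b -> a * e = b * e.
Proof. by case/simP=> [-> | []]. Qed.

Lemma sandwich_idemA a b : sw a b = (a * e) * (e * b).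
Proof. by rewrite !mulgA -(mulgA a) idemA_idem. Qed.

Lemma sandwich_notQ a b : sw a b \notin Q n k.
Proof. by rewrite inE negbK; apply/existsP; exists a; apply/existsP; exists b. Qed.

Lemma notQ_sandwich a : a \notin Q n k -> exists b c, a = sw b c.
Proof. by rewrite inE negbK => /existsP[b /existsP[c /eqP->]]; exists b, c. Qed.

(** A product depends only on [a * e] and [e * b], which are constant on classes; being
    decomposable, it is alone in its class. *)
Lemma class_perms_sub_Aut : class_perms n k \subset AutIS n k.
Proof.
apply/subsetP => s /class_permsP sP; apply/AutISP => a b.
rewrite [RHS]sandwich_idemA -(sim_l _ _ (sP b)) -(sim_r _ _ (sP a)) -sandwich_idemA.
case/simP: (sP (sw a b)) => [// | [+ _ _ _]].
by rewrite (negbTE (sandwich_notQ a b)).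
Qed.

(** * Invariance of ~ under automorphisms, and normality *)

Lemma Aut_pzero phi : phi \in AutIS n k -> phi pzero = pzero.
Proof.
move=> /AutISP phiM.
(* Zero is absorbing; the right factor is chosen so that its image is [pzero]. *)
by rewrite -{1}(sandwich0l (phi^-1 pzero)) phiM permKV sandwich0r.
Qed.

Lemma Aut_Q phi a : phi \in AutIS n k -> (phi a \in Q n k) = (a \in Q n k).
Proof.
move=> phiA; have /AutISP phiM := phiA; have /AutISP phiVM := groupVr phiA.
apply/idP/idP; apply: contraLR => /notQ_sandwich[b [c]].
  by move=> ->; rewrite phiM sandwich_notQ.
by move/(canRL (permK phi)); rewrite phiVM => ->; rewrite sandwich_notQ.
Qed.

(** As [phi] is onto, every test factor [c] is an image, so the criterion by products passes from
    [a] and [b] to their images. *)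
Lemma Aut_sim phi a b : phi \in AutIS n k -> sim k a b -> sim k (phi a) (phi b).
Proof.
move=> phiA /simP[-> | [aQ bQ eab aeb]]; apply/simP; [by left | right].
have /AutISP phiM := phiA; split; rewrite ?Aut_Q //.
  apply/idemA_mul_sandwich => c; rewrite -(permKV phi c) -!phiM.
  by move/idemA_mul_sandwich: eab => ->.
apply/mul_idemA_sandwich => c; rewrite -(permKV phi c) -!phiM.
by move/mul_idemA_sandwich: aeb => ->.
Qed.

Lemma Aut_norm_class_perms : AutIS n k \subset 'N(class_perms n k).
Proof.
apply/subsetP => phi phiA; rewrite inE.
apply/subsetP => _ /imsetP[s /class_permsP sP ->].
apply/class_permsP => a; rewrite /conjg !permM.
by rewrite -{1}(permKV phi a) Aut_sim.
Qed.

(** * The translations given by [sym3] *)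

Lemma sym3P g h1 h2 :
  reflect [/\ perm_on A g, perm_on (~: A) h1 & perm_on (~: A) h2]
          ((g, h1, h2) \in sym3 n k).
Proof.
by rewrite !in_setX /= ![_ \in Sym _]inE -andbA; apply: and3P.
Qed.

Lemma tau_unit_map g h1 h2 x y :
  tau n k (g, h1, h2) (unit_map x y) = unit_map (glue g h1 x) (glue g h2 y).
Proof. by rewrite /= tau_funE translate_unit_map. Qed.

Lemma glue_in g h x : perm_on A g -> perm_on (~: A) h -> x \in A ->
  glue g h x = g x.
Proof. by move=> gA hA xA; rewrite (@glueE n k) ?xA // in_set. Qed.

Lemma glue_stable g h x : perm_on A g -> perm_on (~: A) h ->
  (glue g h x \in A) = (x \in A).
Proof.
move=> gA hA; have [xA | xA] := boolP (x \in A).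
  by rewrite glue_in // (perm_closed x gA).
rewrite (@glueE n k) ?[_ \in Sym _]in_set // (negbTE xA).
by apply/negbTE; rewrite -in_setC (perm_closed x hA) in_setC.
Qed.

Lemma tau_Aut t : t \in sym3 n k -> tau n k t \in AutIS n k.
Proof.
case: t => [[g h1] h2] /sym3P[gA h1A h2A]; apply/AutISP => a b.
(* Both permutations act as [g] on [A] and preserve [A], so they cancel around [e]; this is why [h1]
   and [h2] may be independent. *)
have E : of_perm (glue g h2) * e * of_perm (glue g h1)^-1 = e.
  apply: IS_ext => x; rewrite !mulISE of_permE /= idemAE glue_stable //.
  case: ifP => xA; rewrite idemAE xA //= of_permE.
  by rewrite glue_in // -(glue_in g h1) // permK.
rewrite /= !tau_funE /sandwich -!mulgA; congr (_ * (_ * _)).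
by rewrite !mulgA E.
Qed.

(* Rank-one maps are products, so their classes are singletons. *)
Lemma class_perms_unit_map s x y : (0 < k <= n)%N -> s \in class_perms n k ->
  s (unit_map x y) = unit_map x y.
Proof.
case/andP=> k_gt0 k_le_n /class_permsP/(_ (unit_map x y))/simP[<- // | [+ _ _ _]].
(* [o] is the index 0, which lies in [A] because [0 < k]. *)
pose o := Ordinal (leq_trans k_gt0 k_le_n).
have oA : o \in A by rewrite inE.
by rewrite -(sandwich_unit_map x y o oA) (negbTE (sandwich_notQ _ _)).
Qed.

(** Serves twice: for the injectivity of [tau], and for the trivial intersection of its image with
    the class permutations. *)
Lemma tau_unit_map_fix t : t \in sym3 n k ->
  (forall x y, tau n k t (unit_map x y) = unit_map x y) -> t = 1.
Proof.
case: t => [[g h1] h2] /sym3P[gA h1A h2A] fixt.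
have glue1 x : glue g h1 x = x /\ glue g h2 x = x.
  by apply: unit_map_inj; rewrite -tau_unit_map fixt.
have g1 : g = 1.
  apply/permP => x; rewrite perm1; case: (boolP (x \in A)) => xA.
    by rewrite -(glue_in g h1) // (glue1 x).1.
  by rewrite (out_perm gA xA).
congr (_, _, _) => //; apply/permP => x; rewrite perm1.
  by have := (glue1 x).1; rewrite /glue g1 mul1g.
by have := (glue1 x).2; rewrite /glue g1 mul1g.
Qed.

(** * Automorphisms and their action on rank-one maps *)

Lemma Aut_fix_unit_map phi : phi \in AutIS n k ->
  (forall x y, phi (unit_map x y) = unit_map x y) -> phi \in class_perms n k.
Proof.
move=> phiA fix_unit; have /AutISP phiM := phiA.
have phi0 := Aut_pzero phi phiA.
have el a : e * phi a = e * a.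
  apply: IS_ext => x; rewrite !idemA_mulE; case: ifP => // xA.
  (* The product of [x -> x] and [a] is [x -> a x] or zero; [phi] fixes both, so the value at [x] is
     recovered. *)
  have := phiM (unit_map x x) a; rewrite fix_unit !sandwich_unit_mapl //.
  case: (a x) => [y|]; case: (phi a x) => [z|]; rewrite ?fix_unit ?phi0 //.
  - by case/unit_map_inj=> _ ->.
  - by move/eqP; rewrite (negbTE (unit_map_neq0 _ _)).
  - by move/esym/eqP; rewrite (negbTE (unit_map_neq0 _ _)).
have er a : phi a * e = a * e.
  (* The right-hand product is zero or of rank one, so [phi] fixes it. *)
  have eq_sw y : y \in A -> sw (phi a) (unit_map y y) = sw a (unit_map y y).
    move=> yA; have := phiM a (unit_map y y); rewrite fix_unit => <-.
    by case: (sandwich_unit_mapr_cases a y y yA) => [-> | [x ->]].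
  apply: IS_ext => x; have eq_x y : y \in A -> (phi a x == Some y) = (a x == Some y).
    move=> yA; have := congr1 (fun b : IS n => b x) (eq_sw y yA).
    by rewrite /= !sandwich_unit_mapr //; do 2!case: eqP.
  rewrite !mul_idemA_sends !sendsE.
  case ax: (a x) eq_x => [y|]; case: (phi a x) => [z|] //= eq_x.
  - have [zA | zA] := boolP (z \in A).
      by have := eq_x z zA; rewrite eqxx => /esym/eqP[->]; rewrite zA.
    have [yA | //] := boolP (y \in A).
    by have := eq_x y yA; rewrite eqxx => /eqP[zy]; rewrite zy yA in zA.
  - by case: ifP => // /eq_x; rewrite eqxx.
  - by case: ifP => // /eq_x; rewrite eqxx.
apply/class_permsP => a; apply/simP.
have [aQ | /notQ_sandwich[b [c ->]]] := boolP (a \in Q n k).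
  by right; rewrite Aut_Q.
by left; rewrite phiM [RHS]sandwich_idemA er el -sandwich_idemA.
Qed.

Lemma Aut_unit_map phi : (0 < k <= n)%N -> phi \in AutIS n k ->
  exists2 t, t \in sym3 n k &
    forall x y, phi (unit_map x y) = tau n k t (unit_map x y).
Proof.
case/andP=> k_gt0 k_le_n phiA; have /AutISP phiM := phiA.
have /AutISP phiVM := groupVr phiA.
pose o := Ordinal (leq_trans k_gt0 k_le_n).
have oA : o \in A by rewrite inE.
have phi0 := Aut_pzero phi phiA.
have phi_neq0 a : a != pzero -> phi a != pzero.
  by move=> a_neq0; rewrite -phi0 (inj_eq (@perm_inj _ phi)).
have [p pA phio] : exists2 p, p \in A & phi (unit_map o o) = unit_map p p.
  have idm : sw (phi (unit_map o o)) (phi (unit_map o o)) = phi (unit_map o o).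
    by rewrite -phiM sandwich_unit_map.
  have /pzero_neqP[p [q pq]] := phi_neq0 _ (unit_map_neq0 o o).
  have [pq' pA] := sandwich_idem _ _ _ idm pq; rewrite -{}pq' {q} in pq pA.
  exists p => //.
  have ppE : sw (unit_map p p) (phi (unit_map o o)) = unit_map p p.
    by rewrite sandwich_unit_mapl // pq.
  (* Minimality of [o -> o]: the preimage [u] of [p -> p] is a nonzero idempotent unchanged by right
     multiplication by [o -> o], hence of rank one with target [o], hence equal to [o -> o]. *)
  set u := phi^-1 (unit_map p p).
  have uE : sw u (unit_map o o) = u.
    by rewrite /u -{2}ppE phiVM permK.
  suff -> : unit_map o o = u by rewrite permKV.
  have u_idem : sw u u = u by rewrite /u -phiVM sandwich_unit_map.
  case: (sandwich_unit_mapr_cases u o o oA); rewrite uE.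
    move/(congr1 phi); rewrite /u permKV phi0 => /eqP.
    by rewrite (negbTE (unit_map_neq0 _ _)).
  case=> x ux; have [|xo _] := sandwich_idem u x o u_idem.
    by rewrite ux unit_mapE eqxx.
  by rewrite ux xo.
have phi_l y : exists z, phi (unit_map o y) = unit_map p z.
  have := sandwich_unit_map o y o oA.
  move/(congr1 phi); rewrite phiM phio sandwich_unit_mapl //.
  case: (phi _ p) => [z <-|]; first by exists z.
  by move/esym/eqP; rewrite (negbTE (phi_neq0 _ (unit_map_neq0 _ _))).
have phi_r y : exists z, phi (unit_map y o) = unit_map z p.
  have := sandwich_unit_map y o o oA.
  move/(congr1 phi); rewrite phiM phio.
  case: (sandwich_unit_mapr_cases (phi (unit_map y o)) p p pA) => [-> | [z -> <-]];
    last by exists z.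
  by move/esym/eqP; rewrite (negbTE (phi_neq0 _ (unit_map_neq0 _ _))).
have /fin_all_exists[beta betaE] := phi_l.
have /fin_all_exists[alpha alphaE] := phi_r.
have phi_unit x y : phi (unit_map x y) = unit_map (alpha x) (beta y).
  by rewrite -(sandwich_unit_map x y o oA) phiM alphaE betaE sandwich_unit_map.
have alpha_inj : injective alpha.
  move=> x y xy; have: phi (unit_map x o) = phi (unit_map y o) by rewrite !phi_unit xy.
  by move/perm_inj/unit_map_inj=> [].
have beta_inj : injective beta.
  move=> x y xy; have: phi (unit_map o x) = phi (unit_map o y) by rewrite !phi_unit xy.
  by move/perm_inj/unit_map_inj=> [].
have agree x : x \in A -> alpha x = beta x /\ beta x \in A.
  move=> xA; apply: (sandwich_idem (unit_map (alpha x) (beta x))).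
    by rewrite -phi_unit -phiM sandwich_unit_map.
  by rewrite unit_mapE eqxx.
pose al := perm alpha_inj; pose be := perm beta_inj; pose g := restr_perm A al.
have gA : perm_on A g := restr_perm_on A al.
have alA : al \in 'N(A | 'P).
  rewrite !inE /=; apply/subsetP => x xA; rewrite in_set /= apermE permE.
  by have [-> ?] := agree _ xA.
have gE x : x \in A -> g x = al x by move=> xA; rewrite /g restr_permE.
have gVA x : x \in A -> g^-1 x \in A by move=> xA; rewrite -(perm_closed _ gA) permKV.
(* [al] and [be] both agree with [g] on [A], so dividing by [g] leaves permutations supported off
   [A], and [glue] recovers [al] and [be]. *)
exists (g, g^-1 * al, g^-1 * be).
  apply/sym3P; split=> //; apply/subsetP => x; rewrite !inE; apply: contraR;
    rewrite negbK => xk; have xA : x \in A by rewrite inE.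
    by rewrite permM -gE ?gVA // permKV.
  rewrite permM permE -(agree _ (gVA _ xA)).1.
  by have := gE _ (gVA _ xA); rewrite permKV permE => <-.
by move=> x y; rewrite tau_unit_map /glue !mulKVg !permE phi_unit.
Qed.

End SandwichAutomorphisms.

(** * The semidirect product decomposition *)

Theorem theorem2 (n k : nat) (k_gt0 : (0 < k)%N) (k_le_n : (k <= n)%N) :
  'injm (tau n k) /\
  class_perms n k ><| (tau n k @* sym3 n k) = AutIS n k.
Proof.
have k_bounds : (0 < k <= n)%N by rewrite k_gt0.
have tau_sub : tau n k @* sym3 n k \subset AutIS n k.
  by apply/subsetP => _ /morphimP[t _ tS ->]; apply: tau_Aut.
split.
  apply/injmP => t u tS uS tu; apply/eqP; rewrite eq_mulgV1; apply/eqP.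
  have tuS : t * u^-1 \in sym3 n k by rewrite groupM ?groupV.
  apply: tau_unit_map_fix tuS _ => x y.
  by rewrite morphM ?groupV // morphV // tu mulgV perm1.
rewrite sdprodE; first last.
- apply/trivgP/subsetP => s /setIP[sC /morphimP[t _ tS ts]].
  suff t1 : t = 1 by rewrite inE ts t1 morph1.
  by apply: tau_unit_map_fix tS _ => x y; rewrite -ts (@class_perms_unit_map n k).
- exact: subset_trans tau_sub Aut_norm_class_perms.
apply/eqP; rewrite eqEsubset mul_subG ?class_perms_sub_Aut //=.
apply/subsetP => phi phiA.
have [t tS phit] := Aut_unit_map phi k_bounds phiA.
(* [phi] is its quotient by the translation times the translation; the quotient fixes every rank-one
   map. *)
rewrite -(mulgKV (tau n k t) phi) mem_mulg ?mem_morphim //.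
apply: Aut_fix_unit_map => [|x y]; first by rewrite groupM ?groupV ?tau_Aut.
by rewrite permM phit permK.
Qed.
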